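(* Fix an integer base $b\ge2$. Let $\mathcal{N}$ be a collection of periodic increasing sequences $n_1<n_2<n_3<\dots$ of positive integers. Suppose there exist $K,L\in\mathbb{N}$ such that for every $n\in\mathbb{N}$, the set $\{K(n-1)+L,\,K(n-1)+L+1,\,\dots,\,Kn+L-1\}$ is not a subset of (the set of terms of) any of the sequences in $\mathcal{N}$. Then there exists a real number $0.a_1a_2a_3\dots\in[0,1)$ that is not base-$b$ normal, yet $0.a_{n_1}a_{n_2}a_{n_3}\dots$ is base-$b$ normal for every sequence $n_1<n_2<\dots$ in $\mathcal{N}$.
   Context: $\mathbb{N}=\{1,2,3,\dots\}$. A set $A\subset\mathbb{N}$ (identified with the increasing sequence of its elements) is periodic if there exists $m\in\mathbb{N}$ such that $(A-m)\cap\mathbb{N}=A$, where $A-m=\{a-m:a\in A\}$. For a digit sequence $(a_i)$ with $a_i\in\{0,\dots,b-1\}$, $0.a_1a_2a_3\dots$ is (base-$b$) normal if for every $k\ge1$ and every string $[d_1,\dots,d_k]$ of digits in $\{0,\dots,b-1\}$, $\lim_{n\to\infty}\frac{1}{n}\#\{0\le i\le n-1: a_{i+j}=d_j, j=1,\dots,k\}=b^{-k}$. *)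

(* Defs.v *)
(* Digit expansions and increasing sequences are indexed from 1, as in the
   usual notation: they are functions on nat whose value at 0 is never used. *)
From HB Require Import structures.
From mathcomp Require Import all_boot all_order all_algebra.
From mathcomp Require Import all_classical all_reals all_analysis.
Import Order.TTheory GRing.Theory Num.Theory.
Import numFieldNormedType.Exports.

Set Implicit Arguments.
Unset Strict Implicit.
Unset Printing Implicit Defensive.

Local Open Scope classical_set_scope.
Local Open Scope ring_scope.

Definition pos_increasing (s : nat -> nat) : Prop :=
  (0 < s 1)%N /\ forall k, (0 < k)%N -> (s k < s k.+1)%N.

Definition terms (s : nat -> nat) : set nat := s @` [set k | (0 < k)%N].

(* [set i | A (i + m)] is A - m, up to nonpositive elements. *)
Definition periodic_set (A : set nat) : Prop :=
  exists2 m, (0 < m)%N & [set i | A (i + m)%N] `&` [set i | (0 < i)%N] = A.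

Definition occurrences (b : nat) (a : nat -> 'I_b) (k : nat)
    (d : k.-tuple 'I_b) (n : nat) : {set 'I_n} :=
  [set i : 'I_n | [forall j : 'I_k, a (i + j.+1)%N == tnth d j]]%SET.

Definition normal_digits (R : realType) (b : nat) (a : nat -> 'I_b) : Prop :=
  forall (k : nat) (d : k.-tuple 'I_b), (0 < k)%N ->
    (fun n => #|occurrences a d n|%:R / n%:R : R) @ \oo --> (b%:R ^- k : R).

Definition expansion_of (R : realType) (b : nat) (a : nat -> 'I_b) (x : R) :
    Prop :=
  (fun n => \sum_(1 <= i < n.+1) (a i)%:R / b%:R ^+ i : R) @ \oo --> x.

Definition block (K L n : nat) : set nat :=
  [set i | (K * (n - 1) + L <= i <= K * n + L - 1)%N].

(* Main.v *)
Require Import Defs.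
From HB Require Import structures.
From mathcomp Require Import all_boot all_order all_algebra.
From mathcomp Require Import all_classical all_reals all_analysis.
From mathcomp Require Import ring lra zify.
Import Order.TTheory GRing.Theory Num.Theory.
Import numFieldNormedType.Exports.

Set Implicit Arguments.
Unset Strict Implicit.
Unset Printing Implicit Defensive.

Local Open Scope classical_set_scope.
Local Open Scope ring_scope.

(** Call the intervals [K + L + K j, K + L + K (j + 1)) windows, and require the
    digits of every window to sum to 1 mod b.  Then the word 0^(2K), which would
    cover a whole window, does not occur beyond position K + L, so the expansion
    is not normal.  On the other hand, if the digits of a window are uniform
    subject to this constraint, those lying on a set missing one position of the
    window are independent and uniform.  The random choice is derandomised:
    there are countably many periodic sets A, words w, digits d and rates l; for
    each of them a gambler bets the fraction l of the capital on the digit d each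
    time the digits read so far along A end with w.  The expected capital is
    constant over a window, so the digits can be chosen window by window keeping
    a weighted sum of all capitals bounded.  A gambler with bounded capital
    forces the frequency of w d to be 1/b times that of w along A, up to an
    error of order l, and normality along A follows by induction on w. *)

(** * Averages over the digit strings of one window, free or with prescribed sum *)

Definition shift (G : zmodType) (K : nat) (j : 'I_K) (c : G)
    (g : {ffun 'I_K -> G}) : {ffun 'I_K -> G} :=
  [ffun i => if i == j then g i + c else g i].

Lemma shiftE (G : zmodType) (K : nat) (j : 'I_K) (c : G) (g : {ffun 'I_K -> G}) i :
  shift j c g i = if i == j then g i + c else g i.
Proof. by rewrite ffunE. Qed.

Lemma shift_inj (G : zmodType) (K : nat) (j : 'I_K) (c : G) : injective (shift j c).
Proof.
move=> g h E; apply/ffunP => i; move/ffunP: E => /(_ i).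
by rewrite !shiftE; case: ifP => // _ /addIr.
Qed.

Lemma sum_shift (G : zmodType) (K : nat) (j : 'I_K) (c : G)
    (g : {ffun 'I_K -> G}) :
  \sum_i shift j c g i = \sum_i g i + c.
Proof.
rewrite (bigD1 j) //= [in RHS](bigD1 j) //= shiftE eqxx addrAC.
by congr (_ + _ + _); apply: eq_bigr => i /negPf ij; rewrite shiftE ij.
Qed.

(* Averaging over one coordinate at a time replaces a decomposition of the
   product space. *)
Lemma sum_by_coordinate (R : comPzRingType) (G : finZmodType) (K : nat)
    (j : 'I_K) (f : {ffun 'I_K -> G} -> R) :
  #|G|%:R * \sum_g f g = \sum_g \sum_(c : G) f (shift j c g).
Proof.
rewrite exchange_big /=.
rewrite [RHS](eq_bigr (fun=> \sum_g f g)) => [|c _]; last first.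
  by rewrite [RHS](reindex_inj (@shift_inj _ _ j c)).
by rewrite sumr_const mulr_natl.
Qed.

(** A martingale identity: factor [i] depends only on coordinates up to [i] and has mean 1 over
    coordinate [i]. Averaging over the last coordinate in play leaves the earlier factors fixed, so
    the factors are peeled off one by one. [Y] is indexed by [nat] to allow this induction. *)
Lemma sum_prod_predictable (R : idomainType) (G : finZmodType) (K : nat)
    (Y : nat -> {ffun 'I_K -> G} -> R) :
  #|G|%:R != 0 :> R ->
  (forall (i : 'I_K) (g h : {ffun 'I_K -> G}),
     (forall j : 'I_K, (j <= i)%N -> g j = h j) -> Y i g = Y i h) ->
  (forall (i : 'I_K) g, \sum_(c : G) Y i (shift i c g) = #|G|%:R) ->
  \sum_g \prod_(i < K) Y i g = (#|G| ^ K)%:R.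
Proof.
move=> G0 Yloc Yavg.
suff H m : (m <= K)%N -> \sum_g \prod_(i < m) Y i g = (#|G| ^ K)%:R by exact: H.
elim: m => [_|m IH mK].
  under eq_bigr => g _ do rewrite big_ord0.
  by rewrite sumr_const cardT -cardE card_ffun card_ord.
apply: (mulfI G0); rewrite (sum_by_coordinate (Ordinal mK)) -(IH (ltnW mK)).
rewrite mulr_sumr; apply: eq_bigr => g _.
transitivity (\sum_c (\prod_(i < m) Y i g) * Y m (shift (Ordinal mK) c g)).
  apply: eq_bigr => c _; rewrite big_ord_recr /=; congr (_ * _).
  apply: eq_bigr => i _.
  apply: (Yloc (Ordinal (ltn_trans (ltn_ord i) mK))) => j /= ji.
  rewrite shiftE ifN //; apply/eqP => /(congr1 val) /= E.
  by move: ji; rewrite E leqNgt ltn_ord.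
by rewrite -mulr_sumr (Yavg (Ordinal mK)) mulrC.
Qed.

(** Shifting coordinate [j] by [s - r] maps the strings of sum [r] bijectively to those of sum [s].
    A function blind to coordinate [j] therefore has the same total on every level. *)
Lemma sum_on_level (R : comPzRingType) (G : finZmodType) (K : nat)
    (j : 'I_K) (f : {ffun 'I_K -> G} -> R) (s : G) :
  (forall g c, f (shift j c g) = f g) ->
  #|G|%:R * \sum_(g : {ffun 'I_K -> G} | \sum_i g i == s) f g = \sum_g f g.
Proof.
move=> fj.
rewrite [RHS](partition_big (fun g : {ffun 'I_K -> G} => \sum_i g i) predT) //=.
rewrite mulr_natl -sumr_const; apply: eq_bigr => r _.
rewrite (reindex_inj (@shift_inj _ _ j (s - r))) /=.
apply: eq_big => g; last by rewrite fj.
rewrite sum_shift; apply/eqP/eqP => [|->]; last by rewrite addrC subrK.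
by rewrite -[X in _ = X](subrK r) [_ - r + r]addrC => /addIr.
Qed.

Lemma exists_le_average (R : realDomainType) (I : finType) (P : pred I)
    (f : I -> R) (v : R) (i0 : I) :
  P i0 -> \sum_(i | P i) f i <= #|P|%:R * v -> exists2 i, P i & f i <= v.
Proof.
move=> Pi0 fv; case: (boolP [exists i, P i && (f i <= v)]) => [/existsP[i /andP[]]|].
  by exists i.
move=> /existsPn H; exfalso; move: fv; apply/negP; rewrite -ltNge.
rewrite mulr_natl -sumr_const; apply: ltr_sum.
  by apply/hasP; exists i0; rewrite ?mem_index_enum.
by move=> i Pi; move: (H i); rewrite (Pi : P i) /= -ltNge.
Qed.

(** * Greedy choice of digits, window by window *)

Definition glue (T : Type) (K n : nat) (a : nat -> T) (g : 'I_K -> T) : nat -> T :=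
  fun i => if (n <= i)%N then oapp g (a i) (insub (i - n)%N) else a i.

Definition upd (T : Type) (a : nat -> T) (p : nat) (c : T) : nat -> T :=
  fun i => if i == p then c else a i.

Lemma glue_lt (T : Type) (K n : nat) (a : nat -> T) (g : 'I_K -> T) i :
  (i < n)%N -> glue n a g i = a i.
Proof. by move=> ni; rewrite /glue [(n <= i)%N]leqNgt ni. Qed.

Lemma glue_add (T : Type) (K n : nat) (a : nat -> T) (g : 'I_K -> T) (i : 'I_K) :
  glue n a g (n + i)%N = g i.
Proof. by rewrite /glue leq_addr addKn valK. Qed.

Lemma glue_shift (G : zmodType) (K n : nat) (a : nat -> G) (g : {ffun 'I_K -> G})
    (j : 'I_K) (c : G) :
  glue n a (shift j c g) = upd (glue n a g) (n + j) (g j + c).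
Proof.
apply/funext => i; rewrite /upd /glue.
have [->|ij] := eqVneq; first by rewrite leq_addr addKn valK /= shiftE eqxx.
case: leqP => // ni; case: insubP => //= k _ kE; rewrite shiftE ifN //.
by apply: contraNneq ij => <-; rewrite kE subnKC.
Qed.

(** A gambler blind to position [n + p] cannot notice the constraint on the digit sum: by
    [sum_on_level] its average over the constrained strings is its average over all strings, which
    is 1 by the martingale identity. *)
Lemma sum_window (R : realFieldType) (G : finZmodType) (K n : nat) (p : 'I_K)
    (s : G) (a : nat -> G) (Y : nat -> (nat -> G) -> R) :
  (forall i a a', (forall l, (l <= i)%N -> a l = a' l) -> Y i a = Y i a') ->
  (forall i a, \sum_c Y i (upd a i c) = #|G|%:R) ->
  (forall i a c, Y i (upd a (n + p) c) = Y i a) ->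
  \sum_(g : {ffun 'I_K -> G} | \sum_i g i == s)
    \prod_(i < K) Y (n + i)%N (glue n a g)
  = #|[pred g : {ffun 'I_K -> G} | \sum_i g i == s]|%:R.
Proof.
move=> Yloc Yavg Yskip.
have G0 : #|G|%:R != 0 :> R.
  by rewrite pnatr_eq0 -lt0n; apply/card_gt0P; exists 0.
apply: (mulfI G0); rewrite (sum_on_level (j := p)); last first.
  by move=> g c; apply: eq_bigr => i _; rewrite glue_shift Yskip.
rewrite (@sum_prod_predictable _ _ _ (fun i (g : {ffun 'I_K -> G}) => Y (n + i)%N (glue n a g))) //.
- have -> : #|[pred g : {ffun 'I_K -> G} | \sum_i g i == s]|%:R =
      \sum_(g : {ffun 'I_K -> G} | \sum_i g i == s) 1 :> R by rewrite sumr_const.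
  by rewrite (sum_on_level (j := p)) // sumr_const cardT -cardE card_ffun card_ord.
- move=> i g h gh; apply: Yloc => l lni; rewrite /glue; case: ifP => // nl.
  by case: insubP => //= k _ kE; apply: gh; rewrite kE leq_subLR.
move=> i g; rewrite -(Yavg (n + i)%N (glue n a g)).
rewrite [RHS](reindex_inj (addrI (g i))) /=.
by apply: eq_bigr => c _; rewrite glue_shift.
Qed.

Lemma sum_level_nonempty (G : zmodType) (K : nat) (s : G) :
  (0 < K)%N -> exists g : {ffun 'I_K -> G}, \sum_i g i = s.
Proof.
move=> K0; exists (shift (Ordinal K0) s 0); rewrite sum_shift big1 ?add0r // => i _.
by rewrite ffunE.
Qed.

(* [w t] is the weighted capital of gambler [t] at the start of the window, and
   [Y t i] the factor by which it is multiplied at position [i]. *)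
Lemma greedy_window (R : realFieldType) (G : finZmodType) (K n k : nat) (s : G)
    (a : nat -> G) (Y : nat -> nat -> (nat -> G) -> R) (w : nat -> R) :
  (0 < K)%N ->
  (forall t i a a', (forall l, (l <= i)%N -> a l = a' l) -> Y t i a = Y t i a') ->
  (forall t i a, \sum_c Y t i (upd a i c) = #|G|%:R) ->
  (forall t, exists2 p, (p < K)%N & forall i a c, Y t i (upd a (n + p) c) = Y t i a) ->
  exists a', [/\ forall i, (i < n)%N -> a' i = a i,
    \sum_(i < K) a' (n + i)%N = s &
    \sum_(t < k) w t * \prod_(i < K) Y t (n + i)%N a' <= \sum_(t < k) w t].
Proof.
move=> K0 Yloc Yavg Yskip; have [g0 g0s] := sum_level_nonempty s K0.
have [|g /eqP gs gle] := @exists_le_average R _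
  [pred g : {ffun 'I_K -> G} | \sum_i g i == s]
  (fun g => \sum_(t < k) w t * \prod_(i < K) Y t (n + i)%N (glue n a g))
  (\sum_(t < k) w t) g0 (introT eqP g0s).
  (* The skipped position [p] may differ from gambler to gambler; each average is computed
     separately. *)
  rewrite exchange_big mulr_sumr /=; apply: ler_sum => t _.
  have [p pK pskip] := Yskip t.
  have E := @sum_window R G K n (Ordinal pK) s a (Y t) (Yloc t) (Yavg t) pskip.
  by rewrite -mulr_sumr E mulrC.
exists (glue n a g); split => //.
- by move=> i ni; rewrite glue_lt.
- by rewrite -[RHS]gs; apply: eq_bigr => i _; rewrite glue_add.
Qed.

(** Only finitely many gamblers are active in any window, and their entering weights have total less
    than 2. Keeping the weighted total below that bound controls each capital at window ends;
    factors at most 2 control it elsewhere. *)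
Lemma greedy_sequence (R : realFieldType) (G : finZmodType) (B K : nat) (s : G)
    (Y : nat -> nat -> (nat -> G) -> R) :
  (0 < K)%N ->
  (forall t i a, 0 <= Y t i a <= 2) ->
  (forall t i a a', (forall l, (l <= i)%N -> a l = a' l) -> Y t i a = Y t i a') ->
  (forall t i a, \sum_c Y t i (upd a i c) = #|G|%:R) ->
  (forall t j, exists2 p, (p < K)%N &
     forall i a c, Y t i (upd a (B + K * j + p) c) = Y t i a) ->
  exists a : nat -> G, [/\ forall i, (i < B)%N -> a i = 0,
    forall j, \sum_(i < K) a (B + K * j + i)%N = s &
    forall t, exists C, forall n, \prod_(i < n) Y t i a <= C].
Proof.
move=> K0 Y02 Yloc Yavg Yskip.
pose P t n m a : R := \prod_(n <= i < m) Y t i a.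
have P0 t n m a : 0 <= P t n m a.
  by apply: prodr_ge0 => i _; case/andP: (Y02 t i a).
have Pext t n m (a a' : nat -> G) : (forall l, (l < m)%N -> a l = a' l) ->
    P t n m a = P t n m a'.
  move=> aa'; apply: eq_big_nat => i /andP[_ im]; apply: Yloc => l li.
  by apply: aa'; apply: leq_ltn_trans im.
(* Gambler [t] enters at window [t], with weighted capital [2^-t]. *)
pose W j (a : nat -> G) : R := \sum_(t < j) 2^-1 ^+ t * P t (B + K * t)%N (B + K * j)%N a.
have step j a : exists a', [/\ forall i, (i < B + K * j)%N -> a' i = a i,
    \sum_(i < K) a' (B + K * j + i)%N = s & W j.+1 a' <= W j a + 2^-1 ^+ j].
  have [a' [aa' sa' Wa']] := @greedy_window R G K (B + K * j) j.+1 s a Y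
    (fun t => 2^-1 ^+ t * P t (B + K * t)%N (B + K * j)%N a) K0 Yloc Yavg (fun t => Yskip t j).
  exists a'; split=> //.
  (* Gambler [j] enters now with an empty product, which accounts for the extra [2^-1 ^+ j]. *)
  have -> : W j a + 2^-1 ^+ j =
      \sum_(t < j.+1) 2^-1 ^+ t * P t (B + K * t)%N (B + K * j)%N a.
    by rewrite big_ord_recr /= /P big_geq // mulr1.
  apply: le_trans Wa'; rewrite le_eqVlt; apply/orP; left; apply/eqP.
  apply: eq_bigr => t _; rewrite -mulrA; congr (_ * _).
  have tj : (t <= j)%N by rewrite -ltnS.
  rewrite {1}/P (big_cat_nat (n := (B + K * j)%N)) ?leq_add2l ?leq_mul2l ?tj ?leqnSn ?orbT //=.
  congr (_ * _); first exact/Pext.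
  rewrite -{1}(add0n (B + K * j)%N) big_addn mulnSr addnA addKn big_mkord.
  by apply: eq_bigr => i _; rewrite addnC.
have [F HF] := choice (fun ja : nat * (nat -> G) => step ja.1 ja.2).
have [u [u0 uS]] : exists u : nat -> nat -> G,
    u 0%N = (fun=> 0) /\ forall j, u j.+1 = F (j, u j).
  by exists (fix u j := if j is j'.+1 then F (j', u j') else (fun=> 0)).
have ustab j k i : (j <= k)%N -> (i < B + K * j)%N -> u k i = u j i.
  move=> jk ij; elim: k jk => [|k IH]; first by rewrite leqn0 => /eqP ->.
  rewrite leq_eqVlt => /orP[/eqP -> //|]; rewrite ltnS => jk.
  have [/= H _ _] := HF (k, u k); rewrite uS H ?IH //.
  by apply: leq_trans ij _; rewrite leq_add2l leq_mul2l jk orbT.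
(* Since [K] is positive, position [i] lies below [B + K * i.+1] and is final from stage [i.+1]
   on. *)
pose a i := u i.+1 i.
have au j i : (i < B + K * j)%N -> a i = u j i.
  move=> ij; rewrite /a; have iS : (i < B + K * i.+1)%N.
    by apply: ltn_addl; apply: leq_trans (leq_mul K0 (leqnn i.+1)); rewrite mul1n.
  by case: (leqP j i.+1) => [/ustab|/ltnW /ustab] -> //.
(* The right-hand side is the sum of the entering weights [2^-1 ^+ t] for [t < j]. *)
have Wle j : W j (u j) <= 2 - 2 * 2^-1 ^+ j.
  elim: j => [|j IH]; first by rewrite /W big_ord0 expr0 mulr1 subrr.
  have [/= _ _ H] := HF (j, u j); rewrite uS; apply: le_trans H _.
  rewrite exprS; move: IH; set x := _ ^+ j; lra.
exists a; split.
- by move=> i iB; rewrite (au 0%N) ?u0 // muln0 addn0.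
- move=> j; have [/= _ <- _] := HF (j, u j); apply: eq_bigr => i _.
  by rewrite (au j.+1) ?uS // mulnSr addnA ltn_add2l.
move=> t.
have bound j : P t (B + K * t)%N (B + K * j)%N a <= 2 ^+ t.+1.
  have [tj|jt] := ltnP t j; last first.
    rewrite /P big_geq ?leq_add2l ?leq_mul2l ?jt ?orbT //.
    by apply: exprn_ege1; lra.
  have : 2^-1 ^+ t * P t (B + K * t)%N (B + K * j)%N a <= 2.
    rewrite (Pext _ _ _ _ (u j)); last by move=> l /au.
    (* One summand is at most the whole, as all capitals are nonnegative. *)
    apply: (@le_trans _ _ (W j (u j))).
      rewrite /W (bigD1 (Ordinal tj)) //= lerDl; apply: sumr_ge0 => k _.
      by apply: mulr_ge0 (P0 _ _ _ _); apply: exprn_ge0; rewrite invr_ge0 ler0n.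
    apply: le_trans (Wle j) _; rewrite gerBl mulr_ge0 // exprn_ge0 ?invr_ge0 ?ler0n //.
  by rewrite exprVn ler_pdivrMl ?exprn_gt0 // exprS mulrC.
have Pgrow n m : P t n (n + m)%N a <= 2 ^+ m.
  elim: m => [|m IH]; first by rewrite addn0 /P big_geq.
  rewrite addnS /P big_nat_recr ?leq_addr //= exprSr.
  case/andP: (Y02 t (n + m)%N a) => Y0 Y2.
  by apply: ler_pM => //; apply: P0.
have Psplit n m k : (n <= m)%N -> (m <= k)%N -> P t n k a = P t n m a * P t m k a.
  by move=> nm mk; rewrite /P (big_cat_nat (n := m)).
pose D := (B + K * t)%N.
(* The three exponents bound the product before gambler [t] enters, from there to the last window
   boundary, and in the unfinished window. *)
exists (2 ^+ (D + t.+1 + K)%N) => n; rewrite -(big_mkord predT (fun i => Y t i a)) -/(P t 0%N n a).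
have [nD|Dn] := leqP n D.
  by apply: le_trans (Pgrow 0%N n) _; rewrite ler_weXn2l ?ler1n //; lia.
pose j := ((n - B) %/ K)%N.
have jn : (B + K * j <= n < B + K * j + K)%N.
  have := divn_eq (n - B) K; have := ltn_pmod (n - B) K0; rewrite -/j mulnC /D in Dn *; lia.
have Dj : (D <= B + K * j)%N.
  rewrite leq_add2l leq_mul2l leq_divRL //; apply/orP; right; rewrite mulnC /D in Dn *; lia.
case/andP: jn => jn nj.
rewrite (Psplit _ D n) ?(ltnW Dn) // (Psplit D (B + K * j)%N n) // mulrA.
rewrite exprD (exprD _ D); apply: ler_pM; rewrite ?mulr_ge0 ?P0 //.
  by apply: ler_pM; [exact: P0 | exact: P0 | exact: Pgrow 0%N D | exact: bound].
apply: (@le_trans _ _ (2 ^+ (n - (B + K * j)))).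
  by rewrite -{1}(subnKC jn).
by rewrite ler_weXn2l ?ler1n //; lia.
Qed.

(** * Fair bets along a set of positions *)

Definition history (T : Type) (A : pred nat) (a : nat -> T) (i : nat) : seq T :=
  [seq a p | p <- iota 0 i & A p].

(* The centred outcome of betting on [d] at position [i] of [A] when the digits
   read before [i] along [A] end with [w]. *)
Definition gain (R : realFieldType) (b : nat) (A : pred nat) (w : seq 'I_b)
    (d : 'I_b) (a : nat -> 'I_b) (i : nat) : R :=
  if A i && suffix w (history A a i) then (a i == d)%:R - b%:R^-1 else 0.

Lemma eq_history (T : Type) (A : pred nat) (a a' : nat -> T) i :
  (forall p, (p < i)%N -> A p -> a p = a' p) -> history A a i = history A a' i.
Proof.
move=> aa'; rewrite /history; apply/eq_in_map => p.
by rewrite mem_filter mem_iota add0n => /andP[Ap /andP[_ pi]]; exact: aa'.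
Qed.

Lemma eq_gain (R : realFieldType) (b : nat) (A : pred nat) (w : seq 'I_b)
    (d : 'I_b) (a a' : nat -> 'I_b) i :
  (forall p, (p <= i)%N -> A p -> a p = a' p) ->
  gain R A w d a i = gain R A w d a' i.
Proof.
move=> aa'; rewrite /gain (@eq_history _ _ a a'); last by move=> p /ltnW; exact: aa'.
by case: ifP => // /andP[Ai _]; rewrite (aa' i).
Qed.

Lemma gain_upd (R : realFieldType) (b : nat) (A : pred nat) (w : seq 'I_b)
    (d : 'I_b) (a : nat -> 'I_b) p c i :
  ~~ A p -> gain R A w d (upd a p c) i = gain R A w d a i.
Proof.
move=> nAp; apply: eq_gain => l _ Al; rewrite /upd ifN //.
by apply: contraNneq nAp => <-.
Qed.

(** The bet is fair: the history before [i] does not contain the digit at [i], and exactly one of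
    the [b] values of that digit wins. *)
Lemma sum_gain_upd (R : realFieldType) (b : nat) (A : pred nat) (w : seq 'I_b)
    (d : 'I_b) (a : nat -> 'I_b) i :
  \sum_(c < b) gain R A w d (upd a i c) i = 0.
Proof.
have E c : gain R A w d (upd a i c) i =
    if A i && suffix w (history A a i) then (c == d)%:R - b%:R^-1 else 0.
  rewrite /gain (@eq_history _ _ (upd a i c) a) /upd ?eqxx // => p pi _.
  by rewrite ifN // neq_ltn pi.
under eq_bigr => c _ do rewrite E.
case: (A i && _); last by rewrite big1.
rewrite sumrB (bigD1 d) //= eqxx big1 ?addr0; last by move=> c /negPf ->.
rewrite sumr_const card_ord -[_^-1 *+ b]mulr_natl divff ?subrr // pnatr_eq0.
by case: b d {w a E} => // -[].
Qed.

Lemma gain_norm (R : realFieldType) (b : nat) (A : pred nat) (w : seq 'I_b)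
    (d : 'I_b) (a : nat -> 'I_b) i :
  `|gain R A w d a i| <= 1.
Proof.
rewrite /gain; case: ifP => _; last by rewrite normr0.
have b0 : (0 < b)%N by case: b d {w a} => // -[].
have : b%:R^-1 <= 1 :> R by rewrite invf_le1 ?ler1n ?ltr0n.
have : 0 <= b%:R^-1 :> R by rewrite invr_ge0 ler0n.
by rewrite ler_norml; case: eqP => _ /=; lra.
Qed.

(** * From bounded capital to small sums of gains *)

Lemma expR_le_1Dx (R : realType) (y : R) :
  - 2^-1 <= y -> expR (y - 2 * y ^+ 2) <= 1 + y.
Proof.
move=> y2; have y0 : 0 < 1 + y by lra.
(* After clearing the denominator this is [0 <= y ^+ 2 * (1 + 2 * y)]. *)
have le1 : y - 2 * y ^+ 2 <= y / (1 + y).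
  by rewrite ler_pdivlMr //; nra.
apply: le_trans (_ : expR (y / (1 + y)) <= _); first by rewrite ler_expR.
have := expR_ge1Dx (- (y / (1 + y))).
have -> : 1 + - (y / (1 + y)) = (1 + y)^-1 by field; lra.
rewrite expRN => h; rewrite -[X in X <= _]invrK -[X in _ <= X]invrK.
by rewrite lef_pV2 // posrE invr_gt0 // expR_gt0.
Qed.

(** Each factor is at least the exponential of its argument minus twice its square, and the
    exponential of the sum is at least 1 plus the sum. For [l > 0], division by [l] bounds the sum
    of the [x i] above with a linear error of order [l]; negative [l] gives the lower bound. *)
Lemma bounded_capital (R : realType) (l C : R) (x : nat -> R) (n : nat) :
  `|l| <= 2^-1 -> (forall i, `|x i| <= 1) ->
  \prod_(i < n) (1 + l * x i) <= C ->
  l * \sum_(i < n) x i <= 2 * l ^+ 2 * \sum_(i < n) x i ^+ 2 + C.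
Proof.
move=> l2 x1 le_C.
have : expR (\sum_(i < n) (l * x i - 2 * (l * x i) ^+ 2)) <= C.
  rewrite expR_sum; apply: le_trans le_C; apply: ler_prod => i _.
  rewrite expR_ge0 expR_le_1Dx //.
  have : `|l * x i| <= 2^-1 by rewrite normrM -[leRHS]mulr1 ler_pM.
  by rewrite ler_norml => /andP[].
move/(le_trans (expR_ge1Dx _)); rewrite sumrB -mulr_sumr.
have -> : \sum_(i < n) 2 * (l * x i) ^+ 2 = 2 * l ^+ 2 * \sum_(i < n) x i ^+ 2.
  by rewrite mulr_sumr; apply: eq_bigr => i _; rewrite exprMn mulrA.
lra.
Qed.

(** * Reading positions and digits along an increasing sequence *)

Lemma pos_increasing_lt s m n :
  pos_increasing s -> (0 < m)%N -> (m < n)%N -> (s m < s n)%N.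
Proof.
move=> [_ s_incr] m0; elim: n => // n IH; rewrite ltnS leq_eqVlt => /orP[/eqP <-|mn].
  exact: s_incr.
by apply: ltn_trans (IH mn) (s_incr _ (ltn_trans m0 mn)).
Qed.

(** Both lists are strictly increasing with the same elements. As terms are indexed from 1, exactly
    [m] of them lie below [s m.+1]. *)
Lemma filter_terms s (A : pred nat) m :
  pos_increasing s -> (forall p, A p <-> terms s p) ->
  [seq p <- iota 0 (s m.+1) | A p] = [seq s k | k <- iota 1 m].
Proof.
move=> s_incr As; apply: (irr_sorted_eq ltn_trans ltnn).
- by apply: (sorted_filter ltn_trans); exact: iota_ltn_sorted.
- apply: (homo_sorted_in (P := [pred k | 0 < k]%N) (e := ltn)); last exact: iota_ltn_sorted.
    by move=> x y x0 _; exact: pos_increasing_lt.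
  by apply/allP => x; rewrite mem_iota => /andP[].
move=> p; rewrite mem_filter mem_iota add0n /=; apply/andP/mapP.
  move=> [/As [k /= k0 <-] skm]; exists k => //; rewrite mem_iota k0 add1n ltnNge.
  apply: contraTN skm => mk; rewrite -leqNgt.
  by move: mk; rewrite leq_eqVlt => /orP[/eqP ->//|mk]; apply/ltnW/pos_increasing_lt.
move=> [k]; rewrite mem_iota add1n => /andP[k0 km] ->; split.
  by apply/As; exists k.
exact: pos_increasing_lt.
Qed.

Lemma sum_terms (R : nmodType) s (A : pred nat) (f : nat -> R) m :
  pos_increasing s -> (forall p, A p <-> terms s p) ->
  (forall p, ~~ A p -> f p = 0) ->
  \sum_(i < s m.+1) f i = \sum_(l < m) f (s l.+1).
Proof.
move=> s_incr As f0; rewrite -(big_mkord predT f) /index_iota subn0.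
rewrite (bigID A) /= [X in _ + X]big1 ?addr0; last by move=> i; exact: f0.
rewrite -big_filter (filter_terms m s_incr As) big_map -[X in iota X]addn0 iotaDl.
by rewrite big_map -(big_mkord predT (fun l => f (s l.+1))) /index_iota subn0.
Qed.

Lemma history_terms (T : Type) s (A : pred nat) (a : nat -> T) m :
  pos_increasing s -> (forall p, A p <-> terms s p) ->
  history A a (s m.+1) = mkseq (fun l => a (s l.+1)) m.
Proof.
move=> s_incr As; rewrite /history (filter_terms m s_incr As) -map_comp.
by rewrite -[X in iota X]addn0 iotaDl -map_comp.
Qed.

(** * Word frequencies and normality *)

Definition word_count (T : eqType) (c : nat -> T) (w : seq T) (n : nat) : nat :=
  \sum_(i < n) (mkseq (fun j => c (i + j)%N) (size w) == w).

Lemma suffix_mkseq (T : eqType) (c : nat -> T) (w : seq T) i :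
  suffix w (mkseq c (size w + i)) = (mkseq (fun j => c (i + j)%N) (size w) == w).
Proof.
rewrite suffixE size_mkseq addKn /mkseq -map_drop drop_iota addnC addnK addn0.
by rewrite -[X in iota X]addn0 iotaDl -map_comp.
Qed.

(** The prefix of length [i + size w] ends with [w] exactly when [w] occurs at [i], and the next
    digit decides whether [rcons w d] occurs there. Shorter prefixes contribute nothing. *)
Lemma sum_centered_digits (R : realFieldType) (b : nat) (c : nat -> 'I_b)
    (w : seq 'I_b) (d : 'I_b) (n : nat) :
  \sum_(l < n + size w)
     (if suffix w (mkseq c l) then (c l == d)%:R - b%:R^-1 else 0 : R)
  = (word_count c (rcons w d) n)%:R - (word_count c w n)%:R / b%:R.
Proof.
rewrite addnC big_split_ord /= big1 ?add0r => [|i _]; last first.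
  by case: ifP => // /size_suffix; rewrite size_mkseq leqNgt ltn_ord.
rewrite /word_count !natr_sum mulr_suml -sumrB; apply: eq_bigr => i _.
rewrite suffix_mkseq size_rcons mkseqS eqseq_rcons addnC.
by case: (_ == w) => /=; rewrite ?mul1r // mul0r subrr.
Qed.

Lemma cvg_sublinear (R : realType) (u : nat -> R) (k : nat) :
  (forall e, 0 < e -> exists C, forall m, `|u m| <= e * m%:R + C) ->
  (fun n => u (n + k)%N / n%:R) @ \oo --> (0 : R).
Proof.
move=> small; apply/cvgrPdist_le => e e0.
have [|C HC] := small (e / 2); first by rewrite divr_gt0.
near=> n.
have n0 : 0 < n%:R :> R by near: n; exact: nbhs_infty_gtr.
have nC : (e / 2 * k%:R + C) / (e / 2) < n%:R by near: n; exact: nbhs_infty_gtr.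
rewrite sub0r normrN normrM (ger0_norm (_ : 0 <= n%:R^-1)) ?invr_ge0 ?ler0n //.
rewrite ler_pdivrMr //; apply: le_trans (HC _) _.
by move: nC; rewrite ltr_pdivrMr ?divr_gt0 // natrD; nra.
Unshelve. all: by end_near.
Qed.

(** Induction on the word from its last letter: the empty word has frequency 1, and by
    [sum_centered_digits] appending a letter multiplies the limiting frequency by [b%:R^-1]. *)
Lemma word_count_cvg (R : realType) (b : nat) (c : nat -> 'I_b) :
  (forall (w : seq 'I_b) (d : 'I_b) (e : R), 0 < e -> exists C, forall m,
    `| \sum_(l < m) if suffix w (mkseq c l) then (c l == d)%:R - b%:R^-1 else 0 |
    <= e * m%:R + C) ->
  forall w : seq 'I_b,
    (fun n => (word_count c w n)%:R / n%:R : R) @ \oo --> (b%:R ^- size w : R).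
Proof.
move=> small; elim/last_ind => [|w d IH].
  rewrite expr0 invr1; apply: cvg_near_cst; near=> n.
  rewrite /word_count sum1_card card_ord divff // pnatr_eq0 -lt0n.
  by near: n; exact: nbhs_infty_gt.
have -> : (fun n => (word_count c (rcons w d) n)%:R / n%:R : R) =
    (fun n => (\sum_(l < n + size w)
      if suffix w (mkseq c l) then (c l == d)%:R - b%:R^-1 else 0) / n%:R
      + (word_count c w n)%:R / n%:R * b%:R^-1).
  by apply/funext => n; rewrite sum_centered_digits; ring.
rewrite size_rcons exprSr invfM -[X in _ --> X]add0r.
apply: cvgD; last by apply: cvgM; [exact: IH | exact: cvg_cst].
exact: (@cvg_sublinear R _ (size w) (small w d)).
Unshelve. all: by end_near.
Qed.

Lemma card_occurrences (b k : nat) (a : nat -> 'I_b) (d : k.-tuple 'I_b) n :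
  #|occurrences a d n| = word_count (fun l => a l.+1) d n.
Proof.
rewrite /occurrences /word_count -sum1dep_card big_mkcond /=.
apply: eq_bigr => i _.
suff -> : [forall j : 'I_k, a (i + j.+1)%N == tnth d j] =
  (mkseq (fun j => a (i + j).+1) (size d) == d) by case: eqP.
apply/forallP/eqP => [H|E j]; last first.
  by rewrite (tnth_nth (a 0%N)) -E nth_mkseq ?size_tuple // addnS.
apply: (@eq_from_nth _ (a 0%N)); rewrite size_mkseq // => j jd.
have jk : (j < k)%N by rewrite -(size_tuple d).
rewrite nth_mkseq // -addnS (eqP (H (Ordinal jk))) (tnth_nth (a 0%N)).
by [].
Qed.

(** A countable family of rates of both signs, arbitrarily small and of absolute value at most one
    half. *)
Definition rate (R : realType) (q : nat) (sg : bool) : R := (-1) ^+ sg / q.+2%:R.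

Lemma rate_norm (R : realType) q sg : `|rate R q sg| = q.+2%:R^-1.
Proof. by rewrite normrM normrX normrN1 expr1n mul1r ger0_norm ?invr_ge0. Qed.

Lemma rate_le_half (R : realType) q sg : `|rate R q sg| <= 2^-1.
Proof. by rewrite rate_norm lef_pV2 ?posrE ?ltr0n // ler_nat. Qed.

Lemma normal_along_terms (R : realType) (b : nat) (a : nat -> 'I_b) s (A : pred nat) :
  pos_increasing s -> (forall p, A p <-> terms s p) ->
  (forall w d q sg, exists C, forall n,
     \prod_(i < n) (1 + rate R q sg * gain R A w d a i) <= C) ->
  normal_digits R (a \o s).
Proof.
move=> s_incr As bounded k d _.
have := @word_count_cvg R b (fun l => a (s l.+1)) _ d; rewrite size_tuple.
under [X in X @ _ --> _]funext => n do
  rewrite -[fun l => _]/(fun l => (a \o s) l.+1) -card_occurrences.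
apply=> w {}d e e0.
have gain0 p : ~~ A p -> gain R A w d a p = 0 by rewrite /gain => /negPf ->.
have gainE l : gain R A w d a (s l.+1) =
    if suffix w (mkseq (fun l => a (s l.+1)) l)
    then (a (s l.+1) == d)%:R - b%:R^-1 else 0.
  by rewrite /gain (history_terms _ _ s_incr As) (_ : A _) //; apply/As; exists l.+1.
(* Large enough that the quadratic error, [2 * l] per term, stays below [e]. *)
pose q := Num.truncn (2 / e).
pose l : R := q.+2%:R^-1.
have l0 : 0 < l by rewrite invr_gt0.
have le : 2 * l <= e.
  rewrite ler_pdivrMr // -ler_pdivrMl // mulrC.
  apply: le_trans (ltW (truncnS_gt _)) _; rewrite ler_nat; exact: leqnSn.
have [C1 H1] := bounded w d q false; have [C2 H2] := bounded w d q true.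
have gain1 i : `|gain R A w d a i| <= 1 by exact: gain_norm.
exists ((`|C1| + `|C2|) / l) => m.
have := bounded_capital (rate_le_half R q false) gain1 (H1 (s m.+1)).
have := bounded_capital (rate_le_half R q true) gain1 (H2 (s m.+1)).
have gainsq0 p : ~~ A p -> gain R A w d a p ^+ 2 = 0.
  by move=> nAp; rewrite gain0 ?expr0n.
(* Gains vanish off [A], so up to position [s m.+1] only the first [m] terms count, and the sum of
   squares is at most [m] instead of [s m.+1]. *)
rewrite (sum_terms m s_incr As gain0) (sum_terms m s_incr As gainsq0).
have sq : \sum_(l < m) gain R A w d a (s l.+1) ^+ 2 <= m%:R.
  rewrite -[X in _ <= X%:R]card_ord -sumr_const; apply: ler_sum => i _.
  by rewrite -real_normK ?num_real // expr_le1.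
rewrite (eq_bigr _ (fun i _ => gainE (val i))) /=.
set S := \sum_(l < m) (if _ then _ else _); set Q := \sum_(l < m) _ ^+ 2 in sq *.
have -> : rate R q true = - l by rewrite /rate expr1 mulN1r.
have -> : rate R q false = l by rewrite /rate expr0 mul1r.
have := ler_norm C1; have := ler_norm C2.
have := normr_ge0 C1; have := normr_ge0 C2.
move: (`|C1|) (`|C2|) => c1 c2 c20 c10 C2c C1c; rewrite sqrrN => h2 h1.
have lQ : l ^+ 2 * Q <= l ^+ 2 * m%:R by rewrite ler_pM2l ?exprn_gt0.
have lm : 2 * l ^+ 2 * m%:R <= l * (e * m%:R).
  rewrite expr2 (_ : 2 * (l * l) * m%:R = l * (2 * l * m%:R)); last by ring.
  by rewrite ler_pM2l // ler_wpM2r.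
have -> : e * m%:R + (c1 + c2) / l = (l * (e * m%:R) + (c1 + c2)) / l.
  by field; rewrite gt_eqF.
rewrite ler_pdivlMr // -[X in _ * X](gtr0_norm l0) -normrM mulrC ler_norml.
apply/andP; split; lra.
Qed.

(** * Coding periodic sets by finite boolean words, and the simultaneous play of all gamblers *)

Definition mask_pred (m : seq bool) : pred nat :=
  fun p => (0 < p)%N && nth false m (p %% size m).

Lemma periodic_mask (A : set nat) :
  periodic_set A -> exists m, forall p, mask_pred m p <-> A p.
Proof.
case=> m m0 Am; have E i : A i <-> A (i + m)%N /\ (0 < i)%N.
  by rewrite -{1}Am.
have shiftA k i : (0 < i)%N -> A (i + k * m)%N <-> A i.
  move=> i0; elim: k => [|k IH]; first by rewrite mul0n addn0.
  rewrite -IH (E (i + k * m)%N) mulSn addnCA addnC; split; last by case.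
  by move=> h; split => //; apply: ltn_addr.
(* The residue [r] is tested at [r + m] because 0 is never in [A], even when the multiples of [m]
   are. *)
exists (mkseq (fun r => `[< A (r + m)%N >]) m) => p.
rewrite /mask_pred size_mkseq nth_mkseq ?ltn_pmod //.
have key : (0 < p)%N -> A (p %% m + m)%N <-> A p.
  move=> p0; rewrite -(shiftA 1%N p) // -(shiftA (p %/ m)%N (p %% m + m)%N) ?addn_gt0 ?m0 ?orbT //.
  by rewrite (_ : (_ + _ + _ = p + 1 * m)%N) //; have := divn_eq p m; lia.
split=> [/andP[p0 /asboolP /key]|Ap]; first exact.
have p0 : (0 < p)%N by case/E: Ap.
by rewrite p0; apply/asboolP/key.
Qed.

Lemma window_sequence (R : realType) (b B K : nat) :
  (0 < K)%N ->
  exists a : nat -> 'I_b.+2, [/\ forall i, (i < B)%N -> a i = 0,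
    forall j, \sum_(i < K) a (B + K * j + i)%N = 1 &
    forall m, (forall j, exists2 p, (p < K)%N & ~~ mask_pred m (B + K * j + p)%N) ->
    forall w d q sg, exists C, forall n,
      \prod_(i < n) (1 + rate R q sg * gain R (mask_pred m) w d a i) <= C].
Proof.
move=> K0.
pose adm m := forall j : nat, exists2 p, (p < K)%N & ~~ mask_pred m (B + K * j + p)%N.
pose T : countType := (seq bool * seq 'I_b.+2 * 'I_b.+2 * nat * bool)%type.
(* Numbers that code no gambler, and gamblers whose set contains a whole window, get the constant
   factor 1, so that every [t] meets the hypotheses of [greedy_sequence]. *)
pose Y (t i : nat) (a : nat -> 'I_b.+2) : R :=
  if (unpickle t : option T) is Some (m, w, d, q, sg) then
  if `[< adm m >] then 1 + rate R q sg * gain R (mask_pred m) w d a i else 1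
  else 1.
have [||||| a [a0 a1 aC]] := @greedy_sequence R 'I_b.+2 B K 1 Y => //.
- move=> t i a; rewrite /Y; case: unpickle => [[[[[m w] d] q] sg]|]; last by lra.
  case: ifP => _; last by lra.
  have : `|rate R q sg * gain R (mask_pred m) w d a i| <= 2^-1.
    by rewrite normrM -[leRHS]mulr1 ler_pM ?rate_le_half ?gain_norm.
  by rewrite ler_norml => /andP[]; lra.
- move=> t i a a' aa'; rewrite /Y; case: unpickle => [[[[[m w] d] q] sg]|] //.
  by rewrite (@eq_gain _ _ _ _ _ a a') // => p pi _; exact: aa'.
- have cst : \sum_(c : 'I_b.+2) 1 = #|'I_b.+2|%:R :> R by rewrite sumr_const.
  move=> t i a; rewrite /Y; case: unpickle => [[[[[m w] d] q] sg]|] //.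
  case: asboolP => // _.
  by rewrite big_split /= -mulr_sumr sum_gain_upd mulr0 addr0 -cst.
- move=> t j; rewrite /Y; case: unpickle => [[[[[m w] d] q] sg]|]; last by exists 0%N.
  case: asboolP => [/(_ j)[p pK nm]|_]; last by exists 0%N.
  by exists p => // i a c; rewrite gain_upd.
exists a; split=> // m madm w d q sg.
have [C HC] := aC (pickle ((m, w, d, q, sg) : T)).
exists C => n; move: (HC n); rewrite /Y pickleK.
by case: asboolP.
Qed.

(** * Failure of normality: a long block of zeros is too rare *)

Lemma not_normal_windows (R : realType) (b B K : nat) (a : nat -> 'I_b.+2) :
  (0 < K)%N -> (forall j, \sum_(i < K) a (B + K * j + i)%N = 1) ->
  ~ normal_digits R a.
Proof.
move=> K0 a1; pose z := [tuple of nseq (2 * K) (0 : 'I_b.+2)].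
have absent i : (B <= i)%N -> (mkseq (fun j => a (i + j).+1) (size z) == z) = false.
  move=> Bi; apply/negP => /eqP E.
  have z0 l : (l < 2 * K)%N -> a (i + l).+1 = 0.
    move=> l2; have := congr1 (fun s => nth 0 s l) E.
    by rewrite nth_mkseq ?size_tuple // nth_nseq l2.
  (* The first window starting after [i]; it lies within the [2 * K] positions following [i]. *)
  pose j := ((i - B) %/ K).+1.
  have jP : (i < B + K * j <= i + K)%N.
    by have := divn_eq (i - B) K; have := ltn_pmod (i - B) K0; rewrite /j mulnS mulnC; lia.
  have zw (p : 'I_K) : a (B + K * j + p)%N = 0.
    have pK := ltn_ord p; rewrite -(subnKC (_ : i.+1 <= B + K * j + p)%N); last by lia.
    by rewrite addSn z0 //; lia.
  have /esym/eqP := a1 j; rewrite (eq_bigr (fun=> 0)) => [|p _]; last exact: zw.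
  by rewrite big1_eq oner_eq0.
(* Occurrences can only start before [B], so the frequency tends to 0 instead of the positive limit
   required by normality. *)
have small n : (word_count (fun l => a l.+1) z n <= minn n B)%N.
  elim: n => [|n IH]; first by rewrite /word_count big_ord0.
  have -> : word_count (fun l => a l.+1) z n.+1 = (word_count (fun l => a l.+1) z n +
      (mkseq (fun j => a (n + j).+1) (size z) == z))%N.
    by rewrite /word_count big_ord_recr.
  have [nB|Bn] := ltnP n B; last by rewrite absent // addn0; move: IH; rewrite !leq_min; lia.
  by move: IH; rewrite !leq_min => /andP[IH _]; case: (_ == _); lia.
move=> /(_ _ z); rewrite muln_gt0 K0 => /(_ isT).
have : (fun n => (word_count (fun l => a l.+1) z (n + 0))%:R / n%:R) @ \oo --> (0 : R).
  apply: (@cvg_sublinear R (fun n => (word_count (fun l => a l.+1) z n)%:R)) => e e0.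
  exists B%:R => m; rewrite ger0_norm ?ler0n //.
  rewrite ler_wpDl ?mulr_ge0 ?ler0n ?(ltW e0) // ler_nat.
  by apply: leq_trans (small m) _; exact: geq_minr.
under eq_fun => n do rewrite addn0 -card_occurrences.
move=> c0 c1; have E : 0 = b.+2%:R ^- (2 * K) :> R.
  by apply: (cvg_unique (@norm_hausdorff _ _) c0 c1).
by move/eqP: E; rewrite eq_sym invr_eq0 expf_eq0 pnatr_eq0 andbF.
Qed.

(** * The real number with the given digits *)

Lemma expansion_lt1 (R : realType) (b : nat) (a : nat -> 'I_b.+2) :
  a 1%N = 0 -> exists2 x : R, 0 <= x < 1 & expansion_of a x.
Proof.
move=> a10; pose S n : R := \sum_(1 <= i < n.+1) (a i)%:R / b.+2%:R ^+ i.
have bpos n : 0 < b.+2%:R ^- n :> R by rewrite invr_gt0 exprn_gt0 // ltr0n.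
have SS n : S n.+1 = S n + (a n.+1)%:R * b.+2%:R ^- n.+1.
  by rewrite /S big_nat_recr.
have Sincr : {homo S : n m / (n <= m)%N >-> n <= m}.
  apply/nondecreasing_seqP => n; rewrite SS lerDl mulr_ge0 ?ler0n //; exact: ltW.
(* With first digit 0, the partial sums are at most those of the geometric series with all later
   digits maximal; hence the limit is at most one half, and 1 is excluded. *)
have Sle n : S n.+1 <= b.+2%:R^-1 - b.+2%:R ^- n.+1.
  elim: n => [|n IH].
    by rewrite /S big_nat1 a10 mul0r expr1 subrr.
  rewrite SS; have : (a n.+2)%:R <= b.+2%:R - 1 :> R.
    by rewrite lerBrDr natr1 ler_nat ltn_ord.
  rewrite -(ler_pM2r (bpos n.+2)) => h; apply: le_trans (lerD IH h) _.
  have E : b.+2%:R * b.+2%:R ^- n.+2 = b.+2%:R ^- n.+1 :> R.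
    by rewrite [_ ^+ n.+2]exprS invfM mulrA divff ?mul1r // pnatr_eq0.
  by rewrite mulrBl mul1r E addrA subrK.
have Sub n : S n <= 2^-1.
  apply: le_trans (Sincr _ _ (leqnSn n)) _; apply: le_trans (Sle n) _.
  rewrite lerBlDr ler_wpDr ?(ltW (bpos _)) //.
  by rewrite lef_pV2 ?posrE ?ltr0n // ler_nat.
have ubS : ubound (range S) 2^-1 by move=> _ [n _ <-].
have hub : has_ubound (range S) by exists 2^-1.
exists (sup (range S)); last exact: nondecreasing_cvgn.
apply/andP; split.
  have <- : S 0%N = 0 by rewrite /S big_geq.
  by apply: ub_le_sup => //; exists 0%N.
apply: (@le_lt_trans _ _ 2^-1); last by lra.
by apply: ge_sup => //; exists (S 0%N), 0%N.
Qed.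

Theorem theorem1p4 (R : realType) (b : nat) (hb : (2 <= b)%N)
    (N : set (nat -> nat))
    (hN : forall s, N s -> pos_increasing s /\ periodic_set (terms s))
    (hKL : exists K L : nat, [/\ (0 < K)%N, (0 < L)%N &
       forall n, (0 < n)%N -> forall s, N s -> ~ (block K L n `<=` terms s)]) :
  exists (x : R) (a : nat -> 'I_b),
    [/\ 0 <= x < 1, expansion_of a x, ~ normal_digits R a &
        forall s, N s -> normal_digits R (a \o s)].
Proof.
have [K [L [K0 L0 hblock]]] := hKL.
case: b hb => [|[|b]] // _.
(* Starting the windows at [K + L], which is at least 2, places position 1 among the initial
   zeros. *)
have [a [a0 a1 aC]] := @window_sequence R b (K + L) K K0.
have [x x01 ax] : exists2 x : R, 0 <= x < 1 & expansion_of a x.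
  by apply: expansion_lt1; apply: a0; lia.
exists x, a; split=> //; first exact: not_normal_windows K0 a1.
move=> s Ns; have [s_incr /periodic_mask[m ms]] := hN s Ns.
apply: (normal_along_terms s_incr ms); apply: aC => j.
(* Window [j] starts at [K + L + K * j], so it is block [j.+2]; the missing element of the block is
   the position skipped by the gamblers on [s]. *)
have /existsNP[i /not_implyP[ij nsi]] := hblock j.+2 isT s Ns.
have {ij} ij : (K + L + K * j <= i < K + L + K * j + K)%N.
  by move: ij; rewrite /block /= subn1 /= !mulnS; lia.
exists (i - (K + L + K * j))%N; first lia.
rewrite subnKC; last lia.
by apply/negP => /ms.
Qed.
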